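(* For any integer $\ell\geq 5$ there exists a graph $G$ with an edge $e$ such that $\gamma_g(G)=\ell$ and $\gamma_g(G-e)=\ell-2$.
   Context: Graphs are finite, simple and undirected. A vertex dominates itself and all its neighbors. The domination game on a graph $G$ is played by two players, Dominator and Staller, who alternately choose a vertex of $G$ such that each chosen vertex dominates at least one vertex that was not dominated by the previously chosen vertices. The game ends when all vertices of $G$ are dominated. Dominator wants the total number of chosen vertices to be as small as possible, Staller wants it to be as large as possible. Assuming both play optimally, $\gamma_g(G)$ (the game domination number) is the total number of vertices chosen when Dominator moves first. $G-e$ denotes the graph obtained from $G$ by removing the edge $e$ (keeping all vertices). *)

(* Defs.v *)
From HB Require Import structures.
From mathcomp Require Import all_boot.

Set Implicit Arguments.
Unset Strict Implicit.
Unset Printing Implicit Defensive.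

Record sgraph := SGraph {
  vertex :> finType;
  adj : rel vertex;
  adj_sym : symmetric adj;
  adj_irr : irreflexive adj }.

Section DeleteEdge.
Variables (G : sgraph) (x y : G).

Definition del_edge_adj : rel G :=
  fun u v => adj u v && ([set u; v] != [set x; y]).

Lemma del_edge_sym : symmetric del_edge_adj.
Proof. by move=> u v; rewrite /del_edge_adj adj_sym setUC. Qed.

Lemma del_edge_irr : irreflexive del_edge_adj.
Proof. by move=> u; rewrite /del_edge_adj adj_irr. Qed.

Definition del_edge : sgraph := SGraph del_edge_sym del_edge_irr.

End DeleteEdge.

Inductive player := Dominator | Staller.

Section DominationGame.
Variable G : sgraph.
Implicit Types (S : {set G}) (v : G) (p : player) (n : nat).

Definition closed_nbhd v : {set G} := [set w | (w == v) || adj v w].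

Definition dominated S : {set G} := \bigcup_(v in S) closed_nbhd v.

Definition legal S v : bool := ~~ (closed_nbhd v \subset dominated S).

(* Minimax number of moves still to be made once the vertices in S have been
   chosen and p is to move.  The first argument only bounds the recursion: by
   game_length_bound and game_length_fuel any n >= #|~: dominated S| gives the
   same value.  A legal move exists as long as the game is not over, and no
   game lasts more than #|G| moves, so the default #|G| of the minimum is
   never smaller than the value of a legal move. *)
Fixpoint game_length n p S : nat :=
  if n is n'.+1 then
    if dominated S == [set: G] then 0 else
    (match p with
     | Dominator =>
         \big[minn/#|G|]_(v | legal S v) game_length n' Staller (v |: S)
     | Staller =>
         \max_(v | legal S v) game_length n' Dominator (v |: S)
     end).+1
  else 0.

Definition game_domination_number : nat := game_length #|G| Dominator set0.

Lemma legal_exists S : dominated S != [set: G] -> exists v, legal S v.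
Proof.
move=> nS; have /subsetPn[v _ vS] : ~~ ([set: G] \subset dominated S).
  by rewrite subTset.
by exists v; apply/subsetPn; exists v; rewrite // inE eqxx.
Qed.

Lemma legal_undominated S v :
  legal S v -> #|~: dominated (v |: S)| < #|~: dominated S|.
Proof.
move=> /subsetPn[w wv wS]; apply: proper_card; apply/properP; split.
  rewrite setCS; apply/bigcupsP => u uS.
  by apply: (bigcup_sup u); rewrite // inE uS orbT.
exists w; rewrite inE // negbK; apply/bigcupP; exists v => //.
by rewrite !inE eqxx.
Qed.

Lemma bigminn_le (I : finType) (P : pred I) (F : I -> nat) d i :
  P i -> \big[minn/d]_(j | P j) F j <= F i.
Proof.
move=> Pi; have := mem_index_enum i.
elim: (index_enum I) => [|j r IHr] //; rewrite inE big_cons.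
case/predU1P => [<-|/IHr le_r]; first by rewrite Pi geq_minl.
by case: ifP => // _; rewrite geq_min le_r orbT.
Qed.

Lemma game_length_bound n p S : game_length n p S <= #|~: dominated S|.
Proof.
elim: n p S => [|n IHn] p S //=; case: ifPn => // nS.
have lt_v q v : legal S v -> game_length n q (v |: S) < #|~: dominated S|.
  by move=> lv; apply: leq_ltn_trans (IHn _ _) (legal_undominated lv).
have [v0 lv0] := legal_exists nS.
case: p.
  by apply: leq_ltn_trans (lt_v Staller _ lv0); apply: bigminn_le.
have pos : 0 < #|~: dominated S| by apply: leq_trans (lt_v Staller _ lv0).
rewrite -(prednK pos) ltnS; apply/bigmax_leqP => v lv.
by rewrite -ltnS (prednK pos) lt_v.
Qed.

Lemma game_length_fuel m n p S :
  #|~: dominated S| <= m -> #|~: dominated S| <= n ->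
  game_length m p S = game_length n p S.
Proof.
elim: m n p S => [|m IHm] n p S leSm leSn.
  by apply/esym/eqP; rewrite -leqn0 (leq_trans (game_length_bound _ _ _)).
case: n leSn => [|n] leSn.
  by apply/eqP; rewrite -leqn0 (leq_trans (game_length_bound _ _ _)).
rewrite /=; case: ifP => // _; congr _.+1.
have eq_v q v : legal S v ->
    game_length m q (v |: S) = game_length n q (v |: S).
  by move=> /legal_undominated lv; apply: IHm; rewrite -ltnS (leq_trans lv).
by case: p; apply: eq_bigr => v; apply: eq_v.
Qed.

End DominationGame.

(* Main.v *)
(* Adding two isolated vertices to any graph adds exactly 2 to the game
   domination number: a move on one of them can be answered on the other, and
   neither player gains by making such a move. Hence it is enough to realize
   the drops 5 -> 3 and 6 -> 4, which is done by two explicit graphs whose game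
   trees are searched by computation. In the first one, G - e is the disjoint
   union of a 6-cycle and a path on three vertices: Dominator takes the center
   of the path, and the 6-cycle lasts only 2 moves if Staller starts on it, but
   3 if Dominator does. *)
Require Import Defs.
From mathcomp Require Import all_boot.

Set Implicit Arguments.
Unset Strict Implicit.
Unset Printing Implicit Defensive.

(** * Minimax recursion and optimal moves *)

Definition opponent p := if p is Dominator then Staller else Dominator.

Section GameValue.
Variable G : sgraph.
Implicit Types (S : {set G}) (v w : G) (p : player) (b : nat).

(** The fuel [#|G|] suffices at every position, so values of different positions can be compared
    without tracking it. *)
Definition game_value p S := game_length #|G| p S.

Lemma in_dominated S w :
  (w \in dominated S) = [exists v in S, w \in closed_nbhd v].
Proof.
apply/bigcupP/exists_inP => [[v vS wv]|[v vS wv]]; by exists v.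
Qed.

Lemma dominatedU1 S v : dominated (v |: S) = closed_nbhd v :|: dominated S.
Proof. by rewrite /dominated bigcup_setU big_set1. Qed.

Lemma dominated_set0 : dominated (set0 : {set G}) = set0.
Proof. by rewrite /dominated big_set0. Qed.

Lemma game_value_dominated p S : dominated S = setT -> game_value p S = 0.
Proof.
by rewrite /game_value => SD; case: #|G| => //= n; rewrite SD eqxx.
Qed.

(** A legal move dominates a new vertex, so at most [#|G|.-1] vertices stay undominated and the
    smaller fuel already gives the true value. *)
Lemma game_length_next p S v : legal S v ->
  game_length #|G|.-1 p (v |: S) = game_value p (v |: S).
Proof.
move=> lv; have lt1 := legal_undominated lv.
have leG : #|~: dominated S| <= #|G| by apply: max_card.
apply: game_length_fuel; last exact: max_card.
by rewrite -ltnS (leq_trans lt1) // (leq_trans leG) // leqSpred.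
Qed.

Lemma legal_card_gt0 S v : legal S v -> 0 < #|G|.
Proof. by move=> _; apply/card_gt0P; exists v. Qed.

Lemma legal_not_dominated S v : legal S v -> dominated S != setT.
Proof. by apply: contra => /eqP SD; rewrite SD subsetT. Qed.

Lemma game_valueE p S : dominated S != setT ->
  game_value p S =
    (match p with
     | Dominator =>
         \big[minn/#|G|]_(v | legal S v) game_value Staller (v |: S)
     | Staller =>
         \max_(v | legal S v) game_value Dominator (v |: S)
     end).+1.
Proof.
move=> nS; have [v0 lv0] := legal_exists nS.
rewrite {1}/game_value -{1}(prednK (legal_card_gt0 lv0)) /= (negPf nS).
by congr _.+1; case: p; apply: eq_bigr => v; apply: game_length_next.
Qed.

Lemma game_value_Dominator_le S v : legal S v ->
  game_value Dominator S <= (game_value Staller (v |: S)).+1.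
Proof.
move=> lv; rewrite game_valueE ?(legal_not_dominated lv) // ltnS.
exact: bigminn_le.
Qed.

Lemma game_value_Staller_ge S v : legal S v ->
  (game_value Dominator (v |: S)).+1 <= game_value Staller S.
Proof.
move=> lv; rewrite [leqRHS]game_valueE ?(legal_not_dominated lv) // ltnS.
exact: leq_bigmax_cond.
Qed.

Lemma optimal_move p S : dominated S != setT ->
  exists2 v, legal S v & game_value p S = (game_value (opponent p) (v |: S)).+1.
Proof.
move=> nS; have [v0 lv0] := legal_exists nS; rewrite game_valueE //.
case: p => /=; last first.
  by have [|v lv ->] := eq_bigmax_cond (fun v => game_value Dominator (v |: S))
    (A := legal S); [apply/card_gt0P; exists v0 | exists v].
pose F v := game_value Staller (v |: S).
case: (arg_minnP F lv0) => v lv min_v; exists v => //.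
congr _.+1; apply/eqP; rewrite eqn_leq bigminn_le //=.
(* The default [#|G|] must also be at least [F v]; this holds because a game lasts at most as many
   moves as there are undominated vertices. *)
apply: (big_ind (fun x => F v <= x)) => [||u lu]; last exact: min_v.
  exact: leq_trans (game_length_bound _ _ _) (max_card _).
by move=> a c va vc; rewrite leq_min va.
Qed.

Lemma game_value_eq0 p S : (game_value p S == 0) = (dominated S == setT).
Proof.
apply/idP/eqP => [v0|/game_value_dominated -> //].
by apply/eqP; apply: contraTT v0 => /(optimal_move p)[v _ ->].
Qed.

(** Threshold form of the recursion, matching one level of the boolean search used later. *)
Lemma game_value_Dominator_leS b S : dominated S != setT ->
  (game_value Dominator S <= b.+1)
    = [exists v, legal S v && (game_value Staller (v |: S) <= b)].
Proof.
move=> nS; apply/idP/existsP => [|[v /andP[lv le_b]]]; last first.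
  exact: leq_trans (game_value_Dominator_le lv) _.
by have [v lv ->] := optimal_move Dominator nS; exists v; rewrite lv.
Qed.

Lemma game_value_Staller_leS b S : dominated S != setT ->
  (game_value Staller S <= b.+1)
    = [forall v, legal S v ==> (game_value Dominator (v |: S) <= b)].
Proof.
move=> nS; apply/idP/forallP => [le_b v|all_b].
  by apply/implyP => /game_value_Staller_ge/leq_trans/(_ le_b).
have [v lv ->] := optimal_move Staller nS.
by have /implyP/(_ lv) := all_b v.
Qed.

End GameValue.

(** Deleting an edge from a constructed graph yields the expected adjacency only pointwise; this
    transfers the value without equating the graphs. *)
Lemma eq_game_domination_number (T : finType) (e1 e2 : rel T) s1 s2 i1 i2 :
  e1 =2 e2 ->
  game_domination_number (@SGraph T e1 s1 i1)
    = game_domination_number (@SGraph T e2 s2 i2).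
Proof.
move=> e12; rewrite /game_domination_number /=.
have eqN v : @closed_nbhd (SGraph s1 i1) v = @closed_nbhd (SGraph s2 i2) v.
  by apply/setP => w; rewrite !inE /= e12.
have eqD S : @dominated (SGraph s1 i1) S = @dominated (SGraph s2 i2) S.
  by apply: eq_bigr => v _; apply: eqN.
have eqL S : @legal (SGraph s1 i1) S =1 @legal (SGraph s2 i2) S.
  by move=> v; rewrite /legal eqN eqD.
elim: #|T| Dominator set0 => //= n IHn p S; rewrite eqD.
by case: ifP => // _; congr _.+1; case: p; apply: eq_big => // v _; apply: IHn.
Qed.

(** * Adding one isolated vertex *)

Section AddIsolated.
Variable G : sgraph.

Definition add_isolated_adj (u v : option G) : bool :=
  if (u, v) is (Some u', Some v') then adj u' v' else false.

Lemma add_isolated_sym : symmetric add_isolated_adj.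
Proof. by move=> [u|] [v|] //=; apply: adj_sym. Qed.

Lemma add_isolated_irr : irreflexive add_isolated_adj.
Proof. by move=> [u|] //=; apply: adj_irr. Qed.

Definition add_isolated : sgraph := SGraph add_isolated_sym add_isolated_irr.

Definition lift_set (S : {set G}) : {set add_isolated} := [set Some v | v in S].

(** The positions on [add_isolated G] are of two kinds: [lift_set S], where the new vertex [None] is
    still unplayed, and this one, where it has been played. *)
Definition lift_set_isolated (S : {set G}) : {set add_isolated} :=
  None |: lift_set S.

Lemma lift_setU1 v S : lift_set (v |: S) = Some v |: lift_set S.
Proof. exact: imsetU1. Qed.

Lemma closed_nbhd_Some v :
  closed_nbhd (Some v : add_isolated) = lift_set (closed_nbhd v).
Proof.
apply/setP => -[w|]; last by rewrite inE; apply/esym/imsetP => -[].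
by rewrite mem_imset ?inE //; apply: Some_inj.
Qed.

Lemma closed_nbhd_None : closed_nbhd (None : add_isolated) = [set None].
Proof. by apply/setP => -[w|]; rewrite !inE. Qed.

Lemma dominated_lift_set S : dominated (lift_set S) = lift_set (dominated S).
Proof.
apply/setP => w; rewrite in_dominated; apply/exists_inP/imsetP.
  case=> _ /imsetP[v vS ->]; rewrite closed_nbhd_Some => /imsetP[u uv ->].
  by exists u => //; apply/bigcupP; exists v.
case=> u /bigcupP[v vS uv] ->; exists (Some v); first exact: imset_f.
by rewrite closed_nbhd_Some imset_f.
Qed.

Lemma dominated_lift_set_None S :
  dominated (lift_set_isolated S) = None |: lift_set (dominated S).
Proof. by rewrite dominatedU1 closed_nbhd_None dominated_lift_set. Qed.

Lemma lift_set_not_dominated S : dominated (lift_set S) != setT.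
Proof.
rewrite dominated_lift_set; apply/eqP => /setP/(_ None).
by rewrite inE => /imsetP[].
Qed.

Lemma lift_setS S1 S2 : (lift_set S1 \subset lift_set S2) = (S1 \subset S2).
Proof.
apply/idP/idP => [/subsetP sS|]; last exact: imsetS.
apply/subsetP => v v1; have /imsetP[u u2 [->]] // : Some v \in lift_set S2.
by apply: sS; apply: imset_f.
Qed.

Lemma legal_lift_set_None S : legal (lift_set S) None.
Proof.
rewrite /legal closed_nbhd_None sub1set dominated_lift_set.
by apply/imsetP => -[].
Qed.

Lemma legal_lift_set_Some S v : legal (lift_set S) (Some v) = legal S v.
Proof. by rewrite /legal closed_nbhd_Some dominated_lift_set lift_setS. Qed.

Lemma legal_None_lift_set_Some S v :
  legal (lift_set_isolated S) (Some v) = legal S v.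
Proof.
rewrite /legal closed_nbhd_Some dominated_lift_set_None -lift_setS.
congr (~~ _); apply/subsetP/subsetP => sub w wv; last by rewrite setU1r ?sub.
have /setU1P[w0|//] := sub w wv.
by move: wv; rewrite w0 => /imsetP[].
Qed.

Lemma legal_None_lift_set_None S : legal (lift_set_isolated S) None = false.
Proof.
by rewrite /legal closed_nbhd_None dominated_lift_set_None sub1set setU11.
Qed.

Lemma dominated_None_lift_setT S :
  (dominated (lift_set_isolated S) == setT) = (dominated S == setT).
Proof.
rewrite dominated_lift_set_None; apply/eqP/eqP => /setP DS; apply/setP => v.
  have := DS (Some v); rewrite !inE /=.
  by rewrite mem_imset; last exact: Some_inj.
case: v => [v|]; rewrite !inE //= mem_imset; last exact: Some_inj.
by rewrite DS inE.
Qed.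

(** Once played, [None] is illegal and affects the domination of no other vertex, so the legal moves
    are those of [G]. The induction is on the number of undominated vertices. *)
Lemma game_value_isolated_chosen p S :
  game_value p (lift_set_isolated S) = game_value p S.
Proof.
have [k] := ubnP #|~: dominated S|; elim: k => // k IHk in p S *.
rewrite ltnS => leSk.
have [DS|nDS] := eqVneq (dominated S) setT.
  rewrite !game_value_dominated //.
  by apply/eqP; rewrite dominated_None_lift_setT DS.
have IH q v : legal S v ->
    game_value q ((Some v : add_isolated) |: lift_set_isolated S)
      = game_value q (v |: S).
  move=> lv; rewrite /lift_set_isolated setUCA -lift_setU1 IHk //.
  exact: leq_trans (legal_undominated lv) _.
have nDS' : dominated (lift_set_isolated S) != setT.
  by rewrite dominated_None_lift_setT.
apply/eqP; rewrite eqn_leq; apply/andP; case: p; split.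
- have [v lv ->] := optimal_move Dominator nDS; rewrite -IH //.
  by apply: game_value_Dominator_le; rewrite legal_None_lift_set_Some.
- have [[v|]] := optimal_move Dominator nDS'; last first.
    by rewrite legal_None_lift_set_None.
  rewrite legal_None_lift_set_Some => lv ->; rewrite IH //.
  exact: game_value_Dominator_le.
- have [[v|]] := optimal_move Staller nDS'; last first.
    by rewrite legal_None_lift_set_None.
  rewrite legal_None_lift_set_Some => lv ->; rewrite IH //.
  exact: game_value_Staller_ge.
have [v lv ->] := optimal_move Staller nDS; rewrite -IH //.
by apply: game_value_Staller_ge; rewrite legal_None_lift_set_Some.
Qed.

Lemma game_value_isolated_left p S :
  dominated S = setT -> game_value p (lift_set S) = 1.
Proof.
move=> DS; have [[v|]] := optimal_move p (lift_set_not_dominated S).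
  by rewrite legal_lift_set_Some /legal DS subsetT.
by move=> _ ->; rewrite game_value_isolated_chosen game_value_dominated.
Qed.

End AddIsolated.

(** * Two isolated vertices lengthen the game by exactly 2 *)

Section TwoIsolated.
Variable G : sgraph.
Implicit Types (S : {set G}) (v : G) (p : player).

Definition add_two_isolated := add_isolated (add_isolated G).

Definition lift2 S : {set add_two_isolated} := lift_set (lift_set S).

Lemma lift2U1 v S : lift2 (v |: S) = Some (Some v) |: lift2 S.
Proof. by rewrite /lift2 !lift_setU1. Qed.

Lemma game_value_two_isolated_left p S : dominated S = setT ->
  game_value p (lift2 S) = 2.
Proof.
have nS2 := lift_set_not_dominated (lift_set S).
move=> DS; have [[[v|]|]] := optimal_move p nS2.
- by rewrite !legal_lift_set_Some /legal DS subsetT.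
- rewrite -lift_setU1 => _ ->; congr _.+1.
  apply: game_value_isolated_left.
  by apply/eqP; rewrite dominated_None_lift_setT DS.
by move=> _ ->; rewrite game_value_isolated_chosen game_value_isolated_left.
Qed.

(** Here [u] is one of the two isolated vertices, just played by Dominator. Staller replies on the
    other one, which leaves Dominator to move at [S] in [G]. *)
Lemma Staller_answers_isolated S (u : add_two_isolated) :
    u \notin [set Some (Some v) | v : G] ->
  (game_value Dominator S).+1 <= game_value Staller (u |: lift2 S).
Proof.
case: u => [[v|]|] nu; first by case/imsetP: nu; exists v.
  rewrite -lift_setU1 -(game_value_isolated_chosen _ S).
  rewrite -(game_value_isolated_chosen _ (lift_set_isolated S)).
  exact/game_value_Staller_ge/legal_lift_set_None.
rewrite game_value_isolated_chosen -(game_value_isolated_chosen _ S).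
exact/game_value_Staller_ge/legal_lift_set_None.
Qed.

Lemma Dominator_answers_isolated S (u : add_two_isolated) :
    u \notin [set Some (Some v) | v : G] ->
  game_value Dominator (u |: lift2 S) <= (game_value Staller S).+1.
Proof.
case: u => [[v|]|] nu; first by case/imsetP: nu; exists v.
  rewrite -lift_setU1 -(game_value_isolated_chosen _ S).
  rewrite -(game_value_isolated_chosen _ (lift_set_isolated S)).
  exact/game_value_Dominator_le/legal_lift_set_None.
rewrite game_value_isolated_chosen -(game_value_isolated_chosen _ S).
exact/game_value_Dominator_le/legal_lift_set_None.
Qed.

Lemma game_value_lift2 p S : game_value p (lift2 S) = (game_value p S).+2.
Proof.
have [k] := ubnP #|~: dominated S|; elim: k => // k IHk in p S *.
rewrite ltnS => leSk.
have [DS|nDS] := eqVneq (dominated S) setT.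
  by rewrite game_value_two_isolated_left ?game_value_dominated.
have IH q v : legal S v ->
    game_value q ((Some (Some v) : add_two_isolated) |: lift2 S)
      = (game_value q (v |: S)).+2.
  move=> lv; rewrite -lift2U1 IHk //.
  exact: leq_trans (legal_undominated lv) _.
have legal_lift2 v : legal (lift2 S) (Some (Some v)) = legal S v.
  by rewrite !legal_lift_set_Some.
have nDS' : dominated (lift2 S) != setT := lift_set_not_dominated _.
(* Each optimal move yields one inequality: [v], copied into the larger graph, bounds its value on
   one side, and [u] bounds it on the other. *)
have [u lu opt_u] := optimal_move p nDS'.
have [v lv opt_v] := optimal_move p nDS.
have [/imsetP[w _ uE]|nu] := boolP (u \in [set Some (Some v) | v : G]).
  move: lu opt_u; rewrite {}uE legal_lift2 => lw opt_w.
  apply/eqP; rewrite eqn_leq; apply/andP.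
  case: p opt_w opt_v => /= opt_w opt_v; split.
  - by rewrite opt_v -IH // game_value_Dominator_le ?legal_lift2.
  - by rewrite opt_w IH // !ltnS game_value_Dominator_le.
  - by rewrite opt_w IH // !ltnS game_value_Staller_ge.
  by rewrite opt_v -IH // game_value_Staller_ge ?legal_lift2.
(* Now [u] is isolated, so its inequality comes from the opponent's reply on the other isolated
   vertex; only the one for [v] uses induction. *)
apply/eqP; rewrite eqn_leq; apply/andP.
case: p opt_u opt_v => /= opt_u opt_v; split.
- by rewrite opt_v -IH // game_value_Dominator_le ?legal_lift2.
- by rewrite opt_u ltnS Staller_answers_isolated.
- by rewrite opt_u ltnS Dominator_answers_isolated.
by rewrite opt_v -IH // game_value_Staller_ge ?legal_lift2.
Qed.

Lemma game_domination_number_two_isolated :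
  game_domination_number add_two_isolated = (game_domination_number G).+2.
Proof.
by rewrite -[RHS]game_value_lift2 /lift2 /lift_set !imset0.
Qed.

End TwoIsolated.

(** * Edge deletion commutes with adding an isolated vertex *)

Lemma set2_eq (T : finType) (u v x y : T) :
  ([set u; v] == [set x; y]) = (u == x) && (v == y) || (u == y) && (v == x).
Proof.
apply/eqP/orP => [uvE|[] /andP[/eqP-> /eqP->] //]; last by rewrite setUC.
have : x \in [set u; v] by rewrite uvE set21.
have : y \in [set u; v] by rewrite uvE set22.
have : u \in [set x; y] by rewrite -uvE set21.
have : v \in [set x; y] by rewrite -uvE set22.
rewrite !in_set2 ![_ == u]eq_sym ![_ == v]eq_sym.
by move: (u == x) (u == y) (v == x) (v == y) => [] [] [] []; auto.
Qed.

Lemma del_edge_add_isolated (G : sgraph) (x y : G) :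
  @del_edge_adj (add_isolated G) (Some x) (Some y)
    =2 @add_isolated_adj (del_edge x y).
Proof.
move=> [u|] [v|] //; rewrite /del_edge_adj set2_eq.
by rewrite /add_isolated_adj /= /del_edge_adj set2_eq.
Qed.

(** * Graphs given by edge lists, and a computable game search *)

Section EdgeGraph.
Variables (n : nat) (E : seq (nat * nat)).

(** Symmetrized and without loops, so that every list [E] defines a simple graph. *)
Definition edge_rel (u v : nat) : bool :=
  (u != v) && (((u, v) \in E) || ((v, u) \in E)).

Lemma edge_rel_sym : symmetric edge_rel.
Proof. by move=> u v; rewrite /edge_rel eq_sym orbC. Qed.

Lemma edge_rel_irr : irreflexive edge_rel.
Proof. by move=> u; rewrite /edge_rel eqxx. Qed.

Definition edge_graph : sgraph :=
  @SGraph 'I_n (relpre val edge_rel)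
    (fun u v => edge_rel_sym u v) (fun u => edge_rel_irr u).

Definition nbhd_seq v := [seq w <- iota 0 n | (w == v) || edge_rel v w].

Definition nbhds : seq (seq nat) := [seq nbhd_seq v | v <- iota 0 n].

End EdgeGraph.

(* [Ns] lists the closed neighborhoods, one for each possible move, and [U] the
   vertices not yet dominated. *)
Fixpoint ends_within (Ns : seq (seq nat)) b p (U : seq nat) : bool :=
  if U is [::] then true else
  if b is b'.+1 then
    let legal_nbhd N := has (fun w => w \in N) U in
    let play q N := ends_within Ns b' q [seq w <- U | w \notin N] in
    match p with
    | Dominator => has (fun N => legal_nbhd N && play Staller N) Ns
    | Staller => all (fun N => legal_nbhd N ==> play Dominator N) Ns
    end
  else false.

Lemma ends_withinS Ns b p U : U != [::] ->
  ends_within Ns b.+1 p U =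
    let legal_nbhd N := has (fun w => w \in N) U in
    let play q N := ends_within Ns b q [seq w <- U | w \notin N] in
    match p with
    | Dominator => has (fun N => legal_nbhd N && play Staller N) Ns
    | Staller => all (fun N => legal_nbhd N ==> play Dominator N) Ns
    end.
Proof. by case: U. Qed.

Lemma dominated_eqT n E (S : {set edge_graph n E}) (U : seq nat) :
    {in U, forall w, w < n} ->
    (forall w : edge_graph n E, (val w \in U) = (w \notin dominated S)) ->
  (dominated S == setT) = (U == [::]).
Proof.
move=> ltU memU; apply/eqP/eqP => [DS|U0]; last first.
  by apply/setP => w; rewrite inE -[LHS]negbK -memU U0.
case: U => // u U in ltU memU *.
have := memU (Ordinal (ltU u (mem_head u U))).
by rewrite mem_head DS inE.
Qed.

(** Legal moves and their effect depend on [S] only through its undominated vertices, so the list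
    [U] can stand for the position. Working with lists of numbers lets the search run by
    evaluation. *)
Lemma ends_withinP n E b p (S : {set edge_graph n E}) (U : seq nat) :
    {in U, forall w, w < n} ->
    (forall w : edge_graph n E, (val w \in U) = (w \notin dominated S)) ->
  ends_within (nbhds n E) b p U = (game_value p S <= b).
Proof.
elim: b p S U => [|b IHb] p S U ltU memU.
  rewrite leqn0 game_value_eq0 (dominated_eqT ltU memU).
  by case: U ltU memU.
have [U0|nU0] := eqVneq U [::].
  rewrite game_value_dominated ?U0 //.
  by apply/eqP; rewrite (dominated_eqT ltU memU) U0.
have nS : dominated S != setT by rewrite (dominated_eqT ltU memU).
pose N (v : edge_graph n E) := nbhd_seq n E (val v).
have memN v (w : edge_graph n E) : (val w \in N v) = (w \in closed_nbhd v).
  by rewrite mem_filter mem_iota /= ltn_ord andbT inE.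
have legalN v : has (fun w => w \in N v) U = legal S v.
  apply/hasP/subsetPn => [[w wU wN]|[w wN wS]]; last first.
    by exists (val w); rewrite ?memN ?memU.
  have [v' vE] : {w' : edge_graph n E | val w' = w}.
    by exists (Ordinal (ltU w wU)).
  by rewrite -vE in wU wN; exists v'; rewrite -?memN -?memU.
have IH q v : ends_within (nbhds n E) b q [seq w <- U | w \notin N v]
    = (game_value q (v |: S) <= b).
  apply: IHb => [w|w]; first by rewrite mem_filter => /andP[_ /ltU].
  by rewrite mem_filter memN memU dominatedU1 in_setU negb_or.
have mem_nbhds M : reflect (exists v, M = N v) (M \in nbhds n E).
  apply: (iffP mapP) => [[v]|[v ->]]; last first.
    by exists (val v); rewrite ?mem_iota /=.
  by rewrite mem_iota /= => ltv ->; exists (Ordinal ltv).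
rewrite ends_withinS //; case: p.
  rewrite game_value_Dominator_leS //; apply/hasP/existsP.
    by case=> _ /mem_nbhds[v ->] /andP[lv ev]; exists v; rewrite -legalN lv -IH.
  case=> v /andP[lv ev]; exists (N v); first by apply/mem_nbhds; exists v.
  by rewrite -IH in ev; rewrite -legalN in lv; apply/andP.
rewrite game_value_Staller_leS //; apply/allP/forallP => [all_v v|all_v M].
  by rewrite -legalN -IH; apply/all_v/mem_nbhds; exists v.
by case/mem_nbhds=> v ->; have := all_v v; rewrite -legalN -IH.
Qed.

Lemma game_domination_number_edge_graph n E b :
    ends_within (nbhds n E) b.+1 Dominator (iota 0 n) ->
    ~~ ends_within (nbhds n E) b Dominator (iota 0 n) ->
  game_domination_number (edge_graph n E) = b.+1.
Proof.
have endsE c : ends_within (nbhds n E) c Dominator (iota 0 n)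
    = (game_domination_number (edge_graph n E) <= c).
  apply: ends_withinP => w; rewrite mem_iota //=.
  by rewrite ltn_ord dominated_set0 inE.
by rewrite !endsE -ltnNge => le_b gt_b; apply/eqP; rewrite eqn_leq le_b.
Qed.

(** Since [E] does not already join [x] and [y], deleting the added pair restores [E] exactly. *)
Lemma del_edge_edge_graph n E (x y : 'I_n) :
    ~~ edge_rel E x y ->
  @del_edge_adj (edge_graph n ((val x, val y) :: E)) x y
    =2 @adj (edge_graph n E).
Proof.
move=> nE u v; rewrite /del_edge_adj set2_eq.
case: (boolP (_ || _)) => [|]; rewrite ?andbT ?andbF.
  case/orP=> /andP[/eqP-> /eqP->]; apply/esym/negbTE => //.
  by rewrite /= edge_rel_sym.
rewrite -!val_eqE negb_or => /andP[/negbTE uvN /negbTE vuN].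
by rewrite /= /edge_rel !inE !xpair_eqE uvN [(val v == _) && _]andbC vuN.
Qed.

(** * Drops by two: propagation and the two base graphs *)

Definition game_drop l :=
  exists (G : sgraph) (x y : G),
    [/\ adj x y,
        game_domination_number G = l.+2
      & game_domination_number (del_edge x y) = l].

(** Two isolated vertices raise the values of both [G] and [G - e] by 2, so the drop persists.
    Indexing by the value after deletion avoids truncated subtraction. *)
Lemma game_drop_add2 l : game_drop l -> game_drop l.+2.
Proof.
case=> G [x [y [xy GE dGE]]].
exists (add_two_isolated G), (Some (Some x)), (Some (Some y)); split=> //.
  by rewrite game_domination_number_two_isolated GE.
rewrite -dGE -game_domination_number_two_isolated.
apply: eq_game_domination_number => u v.
rewrite del_edge_add_isolated; case: u v => [u|] [v|] //.
exact: del_edge_add_isolated.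
Qed.

(** [E'] is [G] and [E] is [G - e]. Two searches per graph pin its value from both sides; a single
    boolean hypothesis lets evaluation discharge everything. *)
Lemma game_drop_edge_graph n E b (x y : 'I_n) :
    let E' := (val x, val y) :: E in
    [&& edge_rel E' x y, ~~ edge_rel E x y,
        ends_within (nbhds n E') b.+3 Dominator (iota 0 n),
        ~~ ends_within (nbhds n E') b.+2 Dominator (iota 0 n),
        ends_within (nbhds n E) b.+1 Dominator (iota 0 n) &
        ~~ ends_within (nbhds n E) b Dominator (iota 0 n)] ->
  game_drop b.+1.
Proof.
move=> E' /and5P[xy nxy le3 gt2 /andP[le1 gt0]].
exists (edge_graph n E'), x, y; split=> //.
  exact: game_domination_number_edge_graph.
rewrite -(game_domination_number_edge_graph le1 gt0).
exact/eq_game_domination_number/del_edge_edge_graph.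
Qed.

Definition cycle_and_path :=
  [:: (0, 1); (1, 2); (2, 3); (3, 4); (4, 5); (5, 0); (6, 7); (6, 8)].

Lemma game_drop3 : game_drop 3.
Proof.
(* The edge [e] joins vertex 0 of the 6-cycle to the end 7 of the path centered at 6. *)
apply: (@game_drop_edge_graph 9 cycle_and_path 2
          (@Ordinal 9 0 isT) (@Ordinal 9 7 isT)).
by [].
Qed.

(* Found by computer search. *)
Definition graph13 :=
  [:: (0, 10); (1, 2); (1, 3); (1, 6); (1, 8); (2, 3); (2, 9); (2, 10);
      (4, 6); (4, 7); (4, 9); (5, 8); (5, 9); (6, 7); (8, 10); (10, 11);
      (10, 12)].

Lemma game_drop4 : game_drop 4.
Proof.
(* The edge [e] joins 4 to 11, which in [G - e] is one of the three leaves 0, 11, 12 attached to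
   10. *)
apply: (@game_drop_edge_graph 13 graph13 3
          (@Ordinal 13 4 isT) (@Ordinal 13 11 isT)).
by [].
Qed.

Theorem proposition2p4 (l : nat) (hl : 5 <= l) :
  exists (G : sgraph) (x y : G),
    [/\ adj x y,
        game_domination_number G = l
      & game_domination_number (del_edge x y) = l - 2].
Proof.
(* Isolated vertices come in pairs, so both parities are carried together through the induction. *)
have drop k : game_drop k.+3 /\ game_drop k.+4.
  elim: k => [|k [drop3 drop4]].
    by split; [apply: game_drop3 | apply: game_drop4].
  by split=> //; apply: game_drop_add2.
case: l hl => [|[|[|[|[|k]]]]] // _; rewrite !subSS subn0.
by have [] := drop k.
Qed.
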